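(* Let $X$ be a real inner product space, $Y\subseteq X$, and $f:X\to\mathbb{R}$ a function. Let $(\alpha_n)$ be a sequence of nonnegative reals with $\sum_{i=0}^\infty\alpha_i=\infty$, and $(b_n),(c_n),(d_n)$ sequences of nonnegative reals with $\sum_{i=0}^\infty\alpha_ib_i<\infty$, $\sum_{i=0}^\infty c_i^2<\infty$ and $\sum_{i=0}^\infty d_i<\infty$. Let $x^\ast\in Y$, let $(x_n)$ and $(u_n)$ be sequences in $X$ with $x_n\in Y$ for all $n$, and let $a,p,\theta>0$ be constants, such that for all $n\in\mathbb{N}$: (i) $f(x^\ast)\leq f(x_n)$; (ii) $f(x_n)-f(y)\leq\langle u_n,x_n-y\rangle+b_n$ for all $y\in Y$; (iii) $\|x_{n+1}-x_n\|\leq c_n$; (iv) $\langle\alpha_nu_n,x_n-x^\ast\rangle\leq a\langle x_n-x_{n+1},x_n-x^\ast\rangle+d_n$; (v) $\|u_n\|\leq p$; (vi) $pc_n+b_n\leq\theta\alpha_n$. Then $f(x_n)\to f(x^\ast)$. Moreover, if $r$ is a rate of divergence for $\sum_{i=0}^\infty\alpha_i=\infty$ and $b,c,d,K>0$ satisfy $\sum_{i=0}^\infty\alpha_ib_i\leq b$, $\sum_{i=0}^\infty c_i^2\leq c$, $\sum_{i=0}^\infty d_i\leq d$ and $\|x_0-x^\ast\|^2\leq K$, then for all $\varepsilon>0$ and $g:\mathbb{N}\to\mathbb{N}$ there exists $n\leq\Phi(\varepsilon,g)$ such that $f(x_k)\leq f(x^\ast)+\varepsilon$ for all $k\in[n,n+g(n)]$,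 where $$\Phi(\varepsilon,g):=\tilde h^{(\lceil4\theta e/\varepsilon^2\rceil)}(0),\qquad\tilde h(n):=r\left(n+g(n),\frac{\varepsilon}{2\theta}\right)+1,\qquad e:=\frac{a(c+K)}{2}+b+d.$$
   Context: $\mathbb{Q}_+$ denotes the strictly positive rationals, $[a,a+b]:=\{a,a+1,\dots,a+b\}$, and $\tilde h^{(k)}$ denotes the $k$-fold iterate of $\tilde h$ (with $\tilde h^{(0)}$ the identity). A rate of divergence for $\sum_{i=0}^\infty\alpha_i=\infty$ is a function $r:\mathbb{N}\times\mathbb{Q}_+\to\mathbb{N}$ with $\sum_{i=n}^{r(n,x)}\alpha_i\geq x$ for all $n\in\mathbb{N}$, $x\in\mathbb{Q}_+$, monotone in its first argument ($m\leq n\Rightarrow r(m,x)\leq r(n,x)$).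
   Formalization: In the quantitative part, ε and θ are assumed to be such that ε/(2θ) is rational, since r is defined only on ℕ×ℚ₊ and Φ is otherwise undefined; the convergence part has no such restriction. *)

(* Defs.v *)
From HB Require Import structures.
From mathcomp Require Import all_boot all_order all_algebra.
From mathcomp Require Import all_classical all_reals all_analysis.

Set Implicit Arguments.
Unset Strict Implicit.
Unset Printing Implicit Defensive.

Import Order.TTheory GRing.Theory Num.Theory.
Import numFieldNormedType.Exports.
Local Open Scope ring_scope.

(* A real inner product on [X] is a positive definite symmetric bilinear form,
   [{dot X for idfun}] in [sesquilinear]; completeness is not required. *)
Definition ipnorm (R : realType) (X : lmodType R) (ip : {dot X for idfun})
  (x : X) : R := Num.sqrt (ip x x).

(* The values of [r] at nonpositive rationals are irrelevant.  If [r n q < n]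
   the sum is empty, so the first clause forces [n <= r n q] for [0 < q]. *)
Definition rate_of_divergence (R : realType) (alpha : nat -> R)
    (r : nat -> rat -> nat) : Prop :=
  (forall (n : nat) (q : rat), 0 < q ->
     ratr q <= \sum_(n <= i < (r n q).+1) alpha i) /\
  (forall (m n : nat) (q : rat), 0 < q ->
     (m <= n)%N -> (r m q <= r n q)%N).

Definition htilde (r : nat -> rat -> nat) (q : rat) (g : nat -> nat)
  (n : nat) : nat := (r (n + g n) q + 1)%N.

Definition econst (R : realType) (a b c d K : R) : R :=
  a * (c + K) / 2 + b + d.

(* The rational [q] stands for [eps / (2 * theta)], at which [r] is evaluated.
   For positive arguments the ceiling is positive, so [absz] only casts it to
   [nat]. *)
Definition Phi (R : realType) (theta a b c d K : R) (r : nat -> rat -> nat)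
    (eps : R) (q : rat) (g : nat -> nat) : nat :=
  iter `|Num.ceil (4 * theta * econst a b c d K / eps ^+ 2)|%N
    (htilde r q g) 0%N.

(* Main.v *)
(* Write beta_n = f(x_n) - f(xs).  Polarization turns (iv) into a telescoping
   bound sum alpha_n beta_n <= e, while Cauchy-Schwarz and (vi) give
   beta_n - beta_(n+1) <= theta alpha_n.  Hence if beta_k > eps, then beta stays
   above eps / 2 until the alpha-mass collected from k on reaches
   eps / (2 theta), and this stretch contributes more than eps^2 / (4 theta) to
   the sum.  If metastability failed at each of the first N iterates of h~, these
   would give N disjoint stretches, contradicting the bound e. *)
Require Import Defs.
From HB Require Import structures.
From mathcomp Require Import all_boot all_order all_algebra.
From mathcomp Require Import ring lra.
From mathcomp Require Import all_classical all_reals all_analysis.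

Set Implicit Arguments.
Unset Strict Implicit.
Unset Printing Implicit Defensive.

Import Order.TTheory GRing.Theory Num.Theory.
Import numFieldNormedType.Exports.
Local Open Scope classical_set_scope.
Local Open Scope ring_scope.

Section InnerProduct.
Context (R : realType) (X : lmodType R) (ip : {dot X for idfun}).
Implicit Types v w : X.

Lemma ipC v w : ip v w = ip w v.
Proof. by rewrite hermC/= expr0 mul1r. Qed.

Lemma ip_ge0 v : 0 <= ip v v.
Proof.
have [->|v0] := eqVneq v 0; first by rewrite linear0r.
by rewrite ltW// neq0_dnorm_gt0.
Qed.

Lemma ipnorm_ge0 v : 0 <= ipnorm ip v.
Proof. exact: sqrtr_ge0. Qed.

Lemma sqr_ipnorm v : ipnorm ip v ^+ 2 = ip v v.
Proof. by rewrite sqr_sqrtr// ip_ge0. Qed.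

Lemma ipnorm_gt0 v : v != 0 -> 0 < ipnorm ip v.
Proof. by move=> v0; rewrite sqrtr_gt0 neq0_dnorm_gt0. Qed.

Lemma ipnormB v w : ipnorm ip (v - w) = ipnorm ip (w - v).
Proof. by rewrite /ipnorm -opprB linearNl linearNr/= opprK. Qed.

(** Cauchy-Schwarz: with s, t the norms of v, w, the square of t v - s w equals 2 s t (s t - <v, w>)
    and is nonnegative; for nonzero v, w one may divide by s t. *)
Lemma ip_le_ipnorm v w : ip v w <= ipnorm ip v * ipnorm ip w.
Proof.
have [->|v0] := eqVneq v 0.
  by rewrite linear0l mulr_ge0// ipnorm_ge0.
have [->|w0] := eqVneq w 0.
  by rewrite linear0r mulr_ge0// ipnorm_ge0.
set s := ipnorm ip v; set t := ipnorm ip w.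
have s0 : 0 < s by exact: ipnorm_gt0.
have t0 : 0 < t by exact: ipnorm_gt0.
have := ip_ge0 (t *: v - s *: w).
rewrite linearBl !linearBr/= !linearZl_LR !linearZr_LR/=.
rewrite (ipC w v) -!sqr_ipnorm -/s -/t /GRing.scale/= => H.
rewrite -subr_ge0 -(pmulr_rge0 _ (mulr_gt0 s0 t0)); nra.
Qed.

(* Polarization, applied to [y - x] and [x - z]. *)
Lemma ip_step (x y z : X) :
  2 * ip (x - y) (x - z) =
  ipnorm ip (y - x) ^+ 2 + ipnorm ip (x - z) ^+ 2 - ipnorm ip (y - z) ^+ 2.
Proof.
rewrite !sqr_ipnorm !linearBl !linearBr/= (ipC y x) (ipC z x) (ipC z y).
ring.
Qed.

End InnerProduct.

Section Series.
Context (R : realType) (u : nat -> R) (u_ge0 : forall n, 0 <= u n).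

Lemma nneseries_partial_le (M : R) n :
  (\sum_(0 <= i <oo) (u i)%:E <= M%:E)%E -> \sum_(0 <= i < n) u i <= M.
Proof.
move=> uM; rewrite -lee_fin -sumEFin; apply: le_trans uM.
by apply: nneseries_lim_ge => i _; rewrite lee_fin.
Qed.

Lemma nneseries_lty_bound : (\sum_(0 <= i <oo) (u i)%:E < +oo)%E ->
  exists M, (\sum_(0 <= i <oo) (u i)%:E <= M%:E)%E.
Proof.
move=> uoo; have u0 : (0 <= \sum_(0 <= i <oo) (u i)%:E)%E.
  by apply: nneseries_ge0 => i _ _; rewrite lee_fin.
by exists (fine (\sum_(0 <= i <oo) (u i)%:E)%E); rewrite fineK// ge0_fin_numE.
Qed.

(** If every partial sum started at [n] stayed below [M], the first [n] terms plus [M] would bound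
    the whole series. *)
Lemma nneseries_pinfty_tail (M : R) n : (\sum_(0 <= i <oo) (u i)%:E = +oo)%E ->
  exists m, M <= \sum_(n <= i < m) u i.
Proof.
move=> uoo; apply: contrapT => /forallNP uM.
suff : (\sum_(0 <= i <oo) (u i)%:E <= (\sum_(0 <= i < n) u i + M)%:E)%E.
  by rewrite uoo.
apply: lime_le.
  by apply: is_cvg_nneseries => i _ _; rewrite lee_fin.
apply: nearW => m; rewrite sumEFin lee_fin.
have {}uM : \sum_(n <= i < m) u i <= M by rewrite leNgt; apply/negP => /ltW /uM.
have [nm|/ltnW mn] := leqP n m.
  by rewrite (big_cat_nat (n := n))//= lerD2l.
rewrite [X in _ <= X + _](big_cat_nat (n := m))//= -addrA lerDl addr_ge0 ?sumr_ge0//.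
by apply: le_trans uM; rewrite sumr_ge0.
Qed.

End Series.

Section Metastability.
Context (R : realFieldType) (alpha beta : nat -> R) (theta : R).
Hypothesis alpha_ge0 : forall n, 0 <= alpha n.
Hypothesis beta_ge0 : forall n, 0 <= beta n.
Hypothesis theta_gt0 : 0 < theta.
Hypothesis beta_step : forall n, beta n - beta n.+1 <= theta * alpha n.

Lemma beta_drop m n : (m <= n)%N ->
  beta m - beta n <= theta * \sum_(m <= i < n) alpha i.
Proof.
elim: n => [|n IHn]; first by rewrite leqn0 => /eqP ->; rewrite big_geq// subrr mulr0.
rewrite leq_eqVlt => /predU1P[->|]; first by rewrite big_geq// subrr mulr0.
rewrite ltnS => mn; rewrite big_nat_recr//= mulrDr.
by have := IHn mn; have := beta_step n; lra.
Qed.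

(* Cut the block at the first [m] where the [alpha]-mass from [k] reaches
   [eps / (2 * theta)]: before it, [beta] has lost at most [eps / 2]. *)
Lemma block_sum_gt (eps : R) k l : 0 < eps -> eps < beta k ->
  eps / (2 * theta) <= \sum_(k <= i < l) alpha i ->
  eps ^+ 2 / (4 * theta) < \sum_(k <= i < l) alpha i * beta i.
Proof.
move=> e0 ek kl; set q := eps / (2 * theta).
have q0 : 0 < q by rewrite divr_gt0// mulr_gt0.
have qe : theta * q = eps / 2 by rewrite /q; field; rewrite gt_eqF.
have exm : exists m, q <= \sum_(k <= i < m) alpha i by exists l.
case: (ex_minnP exm) => m qm mmin.
have ml : (m <= l)%N by exact: mmin.
have km : (k <= m)%N.
  rewrite leqNgt; apply/negP => /ltnW mk.
  by move: qm; rewrite big_geq// leNgt q0.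
rewrite (big_cat_nat (n := m))//= ltr_wpDr//.
  by apply: sumr_ge0 => i _; rewrite mulr_ge0.
(* Strictness comes from [beta k - eps / 2 > eps / 2], multiplied by a mass of at least [q > 0]. *)
apply: (@lt_le_trans _ _ ((beta k - eps / 2) * \sum_(k <= i < m) alpha i)).
  have -> : eps ^+ 2 / (4 * theta) = (eps / 2) * q.
    by rewrite /q; field; rewrite gt_eqF.
  apply: (@lt_le_trans _ _ ((beta k - eps / 2) * q)); first by rewrite ltr_pM2r//; lra.
  by rewrite ler_wpM2l//; lra.
rewrite mulr_sumr; apply: ler_sum_nat => i /andP[ki im].
rewrite mulrC ler_wpM2l//.
have : \sum_(k <= j < i) alpha j <= q.
  by rewrite leNgt; apply/negP => /ltW /mmin; rewrite leqNgt im.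
move=> /(ler_wpM2l (ltW theta_gt0)); rewrite qe => mass_le.
by have := beta_drop ki; lra.
Qed.

Context (E eps : R) (rho g : nat -> nat) (N : nat).
Hypothesis sum_le : forall n, \sum_(0 <= i < n) alpha i * beta i <= E.
Hypothesis eps_gt0 : 0 < eps.
Hypothesis rho_rate : forall n, eps / (2 * theta) <= \sum_(n <= i < (rho n).+1) alpha i.
Hypothesis N_gt0 : (0 < N)%N.
Hypothesis N_ge : 4 * theta * E / eps ^+ 2 <= N%:R.

Let h n := (rho (n + g n)).+1.

Lemma rate_ge n : (n <= rho n)%N.
Proof.
rewrite leqNgt; apply/negP => lt_rho; have := rho_rate n.
by rewrite big_geq// leNgt divr_gt0// mulr_gt0.
Qed.

(** Only the mass [eps / (2 * theta)] matters, so an abstract [rho] replaces the rate. This covers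
    both the given [r] at [q] and a [rho] obtained by choice from mere divergence. *)
Lemma metastable : exists n, (n <= iter N h 0)%N /\
  forall k, (n <= k <= n + g n)%N -> beta k <= eps.
Proof.
have h_ge n : (n <= h n)%N.
  by rewrite (leq_trans (leq_addr (g n) n))// ltnW// ltnS rate_ge.
have iter_le j : (j <= N)%N -> (iter j h 0 <= iter N h 0)%N.
  move=> jN; rewrite -(subnK jN) iterD; elim: (N - j)%N => //= i IHi.
  exact: leq_trans IHi (h_ge _).
apply: contrapT => /forallNP nmeta.
(* The first [j] stretches together; [j = 0] is excluded because the inequality is strict. At
   [j = N] it contradicts [sum_le] by [N_ge]. *)
suff sum_gt j : (0 < j <= N)%N ->
    eps ^+ 2 / (4 * theta) * j%:R < \sum_(0 <= i < iter j h 0) alpha i * beta i.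
  have := lt_le_trans (sum_gt N _) (sum_le _); rewrite N_gt0 leqnn => /(_ isT).
  apply/negP; rewrite -leNgt.
  have -> : E = eps ^+ 2 / (4 * theta) * (4 * theta * E / eps ^+ 2).
    by field; rewrite !gt_eqF.
  by rewrite ler_wpM2l// divr_ge0// ?sqr_ge0// mulr_ge0// ltW.
suff step i : (i < N)%N -> eps ^+ 2 / (4 * theta) <
    \sum_(iter i h 0 <= l < iter i.+1 h 0) alpha l * beta l.
  elim: j => // -[_|j IHj] jN.
    by rewrite mulr1; apply: (step 0%N); case/andP: jN.
  rewrite (big_cat_nat (n := iter j.+1 h 0))//=.
  rewrite -[j.+2]addn1 natrD mulrDr mulr1.
  by apply: ltrD; [exact: IHj (ltnW jN) | apply: (step j.+1)].
move=> iN; set n := iter i h 0.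
have /existsNP[k /not_implyP[/andP[nk kn] /negP]] :
    ~ forall k, (n <= k <= n + g n)%N -> beta k <= eps.
  by move=> Hn; apply: (nmeta n); split=> //; exact: iter_le (ltnW iN).
rewrite -ltNge => bk.
have kh : (k <= h n)%N by rewrite (leq_trans kn)// ltnW// ltnS rate_ge.
rewrite (big_cat_nat (n := k))//= ltr_wpDl//.
  by apply: sumr_ge0 => l _; rewrite mulr_ge0.
(* Since [k <= n + g n], the mass from [k] up to [h n] includes the mass that [rho] guarantees from
   [n + g n] on. *)
apply: block_sum_gt => //; apply: (le_trans (rho_rate (n + g n))).
rewrite [leRHS](big_cat_nat (n := n + g n))//=; last by rewrite ltnW// ltnS rate_ge.
by rewrite lerDr sumr_ge0.
Qed.

End Metastability.

Theorem theorem4p2 (R : realType) (X : lmodType R) (ip : {dot X for idfun})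
  (Y : set X) (f : X -> R)
  (alpha b_ c_ d_ : nat -> R)
  (alpha_ge0 : forall n, 0 <= alpha n)
  (alpha_div : (\sum_(0 <= i <oo) (alpha i)%:E = +oo)%E)
  (b_ge0 : forall n, 0 <= b_ n)
  (c_ge0 : forall n, 0 <= c_ n)
  (d_ge0 : forall n, 0 <= d_ n)
  (b_sum : (\sum_(0 <= i <oo) (alpha i * b_ i)%:E < +oo)%E)
  (c_sum : (\sum_(0 <= i <oo) (c_ i ^+ 2)%:E < +oo)%E)
  (d_sum : (\sum_(0 <= i <oo) (d_ i)%:E < +oo)%E)
  (xs : X) (xsY : Y xs)
  (x u : nat -> X) (xY : forall n, Y (x n))
  (a p theta : R) (a_gt0 : 0 < a) (p_gt0 : 0 < p) (theta_gt0 : 0 < theta)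
  (h1 : forall n, f xs <= f (x n))
  (h2 : forall n y, Y y -> f (x n) - f y <= ip (u n) (x n - y) + b_ n)
  (h3 : forall n, ipnorm ip (x n.+1 - x n) <= c_ n)
  (h4 : forall n, ip (alpha n *: u n) (x n - xs)
                  <= a * ip (x n - x n.+1) (x n - xs) + d_ n)
  (h5 : forall n, ipnorm ip (u n) <= p)
  (h6 : forall n, p * c_ n + b_ n <= theta * alpha n) :
  (f (x n) @[n --> \oo] --> f xs) /\
  (forall (r : nat -> rat -> nat) (b c d K : R),
     rate_of_divergence alpha r ->
     0 < b -> 0 < c -> 0 < d -> 0 < K ->
     (\sum_(0 <= i <oo) (alpha i * b_ i)%:E <= b%:E)%E ->
     (\sum_(0 <= i <oo) (c_ i ^+ 2)%:E <= c%:E)%E ->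
     (\sum_(0 <= i <oo) (d_ i)%:E <= d%:E)%E ->
     ipnorm ip (x 0%N - xs) ^+ 2 <= K ->
     forall (eps : R) (q : rat) (g : nat -> nat),
       0 < eps -> ratr q = eps / (2 * theta) ->
       exists n : nat,
         (n <= Phi theta a b c d K r eps q g)%N /\
         forall k : nat, (n <= k <= n + g n)%N -> f (x k) <= f xs + eps).
Proof.
set beta := fun n => f (x n) - f xs.
have beta_ge0 n : 0 <= beta n by rewrite subr_ge0.
(* Use (ii) at y = x_(n+1), then Cauchy-Schwarz with (iii) and (v). *)
have beta_step n : beta n - beta n.+1 <= theta * alpha n.
  apply: le_trans (h6 n); rewrite /beta opprB addrA subrK.
  apply: (le_trans (h2 n _ (xY n.+1))); rewrite lerD2r.
  apply: (le_trans (ip_le_ipnorm _ _ _)).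
  by rewrite ipnormB ler_pM ?ipnorm_ge0.
have sum_le (b c d K : R) :
    (\sum_(0 <= i <oo) (alpha i * b_ i)%:E <= b%:E)%E ->
    (\sum_(0 <= i <oo) (c_ i ^+ 2)%:E <= c%:E)%E ->
    (\sum_(0 <= i <oo) (d_ i)%:E <= d%:E)%E ->
    ipnorm ip (x 0%N - xs) ^+ 2 <= K ->
    forall n, \sum_(0 <= i < n) alpha i * beta i <= econst a b c d K.
  move=> bb cc dd KK n.
  have {}bb : \sum_(0 <= i < n) alpha i * b_ i <= b.
    by apply: nneseries_partial_le bb => i; rewrite mulr_ge0.
  have {}cc : \sum_(0 <= i < n) c_ i ^+ 2 <= c.
    by apply: nneseries_partial_le cc => i; rewrite sqr_ge0.
  have {}dd : \sum_(0 <= i < n) d_ i <= d by exact: nneseries_partial_le dd.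
  (* The subtracted squared distance of [x n] to [xs] is what makes the induction telescope; it is
     dropped only at the end. *)
  have : \sum_(0 <= i < n) alpha i * beta i <=
      a / 2 * (\sum_(0 <= i < n) c_ i ^+ 2 + ipnorm ip (x 0%N - xs) ^+ 2
               - ipnorm ip (x n - xs) ^+ 2) +
      \sum_(0 <= i < n) alpha i * b_ i + \sum_(0 <= i < n) d_ i.
    elim: n {bb cc dd} => [|n IHn]; first by rewrite !big_geq//; lra.
    rewrite !big_nat_recr//=.
    have abn : alpha n * beta n <=
        a * ip (x n - x n.+1) (x n - xs) + d_ n + alpha n * b_ n.
      apply: le_trans (lerD (h4 n) (lexx _)).
      by rewrite linearZl_LR/= -mulrDr ler_wpM2l// h2.
    have cn : ipnorm ip (x n.+1 - x n) ^+ 2 <= c_ n ^+ 2.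
      by rewrite lerXn2r ?nnegrE ?ipnorm_ge0.
    have := ip_step ip (x n) (x n.+1) xs; nra.
  have := sqr_ge0 (ipnorm ip (x n - xs)); rewrite /econst; nra.
split; last first.
  move=> r b c d K [r_rate _] b0 c0 d0 K0 bb cc dd KK eps q g e0 qE.
  have E0 : 0 < econst a b c d K by rewrite /econst; nra.
  have C0 : 0 < 4 * theta * econst a b c d K / eps ^+ 2.
    by rewrite divr_gt0 ?exprn_gt0// !mulr_gt0.
  have q0 : 0 < q by rewrite -(ltr0q R) qE divr_gt0// mulr_gt0.
  have [|||n [nN nb]] := @metastable _ alpha beta theta alpha_ge0 beta_ge0 theta_gt0
      beta_step (econst a b c d K) eps (r ^~ q) g
      `|Num.ceil (4 * theta * econst a b c d K / eps ^+ 2)|%N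
      (sum_le _ _ _ _ bb cc dd KK) e0.
  - by move=> n; rewrite -qE; exact: r_rate.
  - by rewrite absz_gt0 gt_eqF// ceil_gt0.
  - by rewrite natr_absz gtr0_norm ?ceil_gt0// ceil_ge.
  exists n; split; last by move=> k /nb; rewrite /beta lerBlDl.
  rewrite /Phi (eq_iter (f' := fun m => (r (m + g m) q).+1))// => m.
  by rewrite /htilde addn1.
have [b bb] : exists b, (\sum_(0 <= i <oo) (alpha i * b_ i)%:E <= b%:E)%E.
  by apply: nneseries_lty_bound => // i; rewrite mulr_ge0.
have [c cc] : exists c, (\sum_(0 <= i <oo) (c_ i ^+ 2)%:E <= c%:E)%E.
  by apply: nneseries_lty_bound => // i; rewrite sqr_ge0.
have [d dd] : exists d, (\sum_(0 <= i <oo) (d_ i)%:E <= d%:E)%E.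
  exact: nneseries_lty_bound.
set E := econst a b c d (ipnorm ip (x 0%N - xs) ^+ 2).
apply/cvgrPdist_le => eps e0.
suff [n nb] : exists n, forall k, (n <= k)%N -> beta k <= eps.
  exists n => // k /= nk; rewrite distrC ger0_norm; [exact: nb|exact: beta_ge0].
(* A failure of convergence yields a [g] contradicting metastability. *)
apply: contrapT => /forallNP ncvg.
have /choice[g gP] n : exists m, eps < beta (n + m)%N.
  have /existsNP[k /not_implyP[nk /negP]] := ncvg n.
  by rewrite -ltNge => bk; exists (k - n)%N; rewrite subnKC.
(* Here [eps / (2 * theta)] may be irrational, so [rho] comes directly from the divergence of the
   series. *)
have /choice[rho rhoP] n :
    exists m, eps / (2 * theta) <= \sum_(n <= i < m.+1) alpha i.
  have [m mP] := nneseries_pinfty_tail alpha_ge0 (eps / (2 * theta)) n alpha_div.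
  case: m mP => [|m mP]; last by exists m.
  by rewrite big_geq// leNgt divr_gt0// mulr_gt0.
(* Any large enough number of iterations will do; the successor makes it positive. *)
have [||n [_ nb]] := @metastable _ alpha beta theta alpha_ge0 beta_ge0 theta_gt0
    beta_step E eps rho g (Num.bound `|4 * theta * E / eps ^+ 2|).+1
    (sum_le _ _ _ _ bb cc dd (lexx _)) e0 rhoP.
- by [].
- apply: (le_trans (ler_norm _)); apply/ltW.
  by apply: (lt_le_trans (archi_boundP (normr_ge0 _))); rewrite ler_nat.
(* The right endpoint of the interval is the index where [g] was chosen to make [beta] exceed
   [eps]. *)
have := nb (n + g n)%N; rewrite leq_addr leqnn => /(_ isT).
by apply/negP; rewrite -ltNge.
Qed.
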